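(* Let $X$ be a non-empty set, let $\sim$ be an equivalence relation on $\operatorname{Div}(X)$ satisfying (E1) and (E2), let $g\ge 0$ be an integer, and let $K\in\operatorname{Div}(X)$ have degree $2g-2$. Define $\epsilon:\operatorname{Div}(X)\to\mathbb{Z}/2\mathbb{Z}$ by $\epsilon(D)=0$ if $|D|\neq\emptyset$ and $\epsilon(D)=1$ if $|D|=\emptyset$. Then the formula \[ r(D)-r(K-D)=\deg(D)+1-g \] holds for all $D\in\operatorname{Div}(X)$ if and only if both of the following hold: (RR1) for every $D\in\operatorname{Div}(X)$ there exists $\nu\in\mathcal{N}$ with $\epsilon(D)+\epsilon(\nu-D)=1$; (RR2) for every $D\in\operatorname{Div}(X)$ with $\deg(D)=g-1$, $\epsilon(D)+\epsilon(K-D)=0$.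
   Context: $\operatorname{Div}(X)$ is the free abelian group on the set $X$; elements $D=\sum_x D(x)(x)$ (finitely many nonzero), $D\ge 0$ (effective) iff all coefficients are $\ge 0$, $\deg(D)=\sum_x D(x)$. The equivalence relation satisfies: (E1) if $D\sim D'$ then $\deg(D)=\deg(D')$; (E2) if $D_1\sim D_1'$ and $D_2\sim D_2'$ then $D_1+D_2\sim D_1'+D_2'$. $|D|=\{E\in\operatorname{Div}(X): E\ge 0,\ E\sim D\}$. $r(D)\in\{-1,0,1,\dots\}$ is defined by: for each integer $s\ge 0$, $r(D)\ge s$ iff $|D-E|\ne\emptyset$ for all effective $E$ of degree $s$ (and $r(D)=-1$ if $|D|=\emptyset$). $\mathcal{N}=\{D\in\operatorname{Div}(X):\deg(D)=g-1,\ |D|=\emptyset\}$. *)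

(* Defs.v *)
From mathcomp Require Export all_boot all_order all_algebra.
From mathcomp Require Export freeg.
From mathcomp Require Export boolp classical_sets.
From Corelib Require Export RelationClasses.
From mathcomp Require Import zify.

Set Implicit Arguments.
Unset Strict Implicit.
Unset Printing Implicit Defensive.

Import Order.TTheory GRing.Theory Num.Theory.
Local Open Scope ring_scope.
Local Open Scope classical_set_scope.

Definition effective (X : choiceType) (D : {freeg X}) : Prop :=
  forall x : X, 0 <= coeff x D.

Definition linsys (X : choiceType) (eqv : {freeg X} -> {freeg X} -> Prop)
    (D : {freeg X}) : set {freeg X} :=
  [set E | effective E /\ eqv E D].

Definition is_rank (X : choiceType) (eqv : {freeg X} -> {freeg X} -> Prop)
    (D : {freeg X}) : set int :=
  [set r : int | -1 <= r /\
    forall s : nat, s%:Z <= r <->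
      (forall E : {freeg X}, effective E -> deg E = s%:Z ->
         linsys eqv (D - E) !=set0)].

(* [xget] returns an element of [is_rank eqv D], or the default -1 if there is
   none.  By [rankP] and [is_rank_unique] below, [is_rank eqv D] is a singleton
   under the hypotheses in force, so the default plays no role.  The case
   [s = 0] gives [rank eqv D = -1] exactly when [linsys eqv D] is empty
   ([rankN1P]). *)
Definition rank (X : choiceType) (eqv : {freeg X} -> {freeg X} -> Prop)
    (D : {freeg X}) : int :=
  xget (-1) (is_rank eqv D).

Definition calN (X : choiceType) (eqv : {freeg X} -> {freeg X} -> Prop)
    (g : nat) : set {freeg X} :=
  [set D | deg D = g%:Z - 1 /\ linsys eqv D = set0].

Definition eps (X : choiceType) (eqv : {freeg X} -> {freeg X} -> Prop)
    (D : {freeg X}) : 'Z_2 :=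
  if `[< linsys eqv D !=set0 >] then 0 else 1.

Lemma effectiveD (X : choiceType) (D E : {freeg X}) :
  effective D -> effective E -> effective (D + E).
Proof. by move=> hD hE x; rewrite coeffD addr_ge0. Qed.

Lemma effectiveU (X : choiceType) (n : nat) (x : X) :
  effective << n%:Z *g x >>.
Proof. by move=> y; rewrite coeffU mulr_ge0. Qed.

Lemma deg_effective_ge0 (X : choiceType) (D : {freeg X}) :
  effective D -> 0 <= deg D.
Proof.
move=> hD; rewrite -[D]freeg_sumE raddf_sum /=.
by apply: sumr_ge0 => x _; rewrite degU; apply: hD.
Qed.

Lemma deg_effective_eq0 (X : choiceType) (D : {freeg X}) :
  effective D -> deg D = 0 -> D = 0.
Proof.
move=> hD dD; apply/eqP/freeg_eqP => x; rewrite coeff0; apply/eqP.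
rewrite eq_le hD andbT.
have := @deg_effective_ge0 X (D - << coeff x D *g x >>).
rewrite degB degU dD sub0r oppr_ge0; apply.
by move=> y; rewrite coeffB coeffU; case: eqVneq => [->|_];
  rewrite ?mulr1 ?subrr ?mulr0 ?subr0.
Qed.

Lemma is_rank_unique (X : choiceType) (eqv : {freeg X} -> {freeg X} -> Prop)
    (D : {freeg X}) (r r' : int) :
  is_rank eqv D r -> is_rank eqv D r' -> r = r'.
Proof.
wlog: r r' / r <= r' => [W|lerr'].
  by case/orP: (le_total r r') => h hr hr'; [|apply/esym]; apply: W.
move=> [ger hr] [ger' hr']; apply/eqP; rewrite eq_le lerr' /=.
case: r' ger' lerr' hr' => [s|[|s]] // _ _ hr'.
by apply/hr/hr'.
Qed.

Lemma rankP (X : choiceType) (hX : inhabited X)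
    (eqv : {freeg X} -> {freeg X} -> Prop) (eqvE : Equivalence eqv)
    (E1 : forall D D' : {freeg X}, eqv D D' -> deg D = deg D')
    (E2 : forall D1 D1' D2 D2' : {freeg X},
       eqv D1 D1' -> eqv D2 D2' -> eqv (D1 + D2) (D1' + D2'))
    (D : {freeg X}) :
  is_rank eqv D (rank eqv D).
Proof.
case: hX => x0; rewrite /rank.
pose Q (s : nat) := forall E : {freeg X}, effective E -> deg E = s%:Z ->
  linsys eqv (D - E) !=set0.
suff [r hr] : exists r, is_rank eqv D r by apply: (xgetPex _ (ex_intro _ r hr)).
have QS s : Q s.+1 -> Q s.
  move=> hQ E hE dE.
  have [||F [hF eF]] := hQ (E + << 1 *g x0 >>).
  - by apply: effectiveD => //; exact: (effectiveU 1).
  - by rewrite degD degU dE; lia.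
  exists (F + << 1 *g x0 >>); split.
    by apply: effectiveD => //; exact: (effectiveU 1).
  have := E2 _ _ _ _ eF (@Equivalence_Reflexive _ _ eqvE << 1 *g x0 >>).
  by rewrite opprD addrA subrK.
have Qle s t : (s <= t)%N -> Q t -> Q s.
  by move/subnK <-; elim: (t - s)%N => [//|k IH] /QS.
have Qb s : Q s -> (s <= `|deg D|)%N.
  move=> /(_ << s%:Z *g x0 >> (effectiveU _ _) (degU _ _)) [F [hF /E1]].
  by rewrite degB degU => dF; have := deg_effective_ge0 hF; lia.
case: (pselect (Q 0%N)) => Q0; last first.
  exists (-1); split=> // s; split=> [|/(Qle 0%N s (leq0n s))//]; lia.
have ex : exists n, `[< Q n >] by exists 0%N; apply/asboolP.
have ub n : `[< Q n >] -> (n <= `|deg D|)%N by move/asboolP/Qb.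
case: (ex_maxnP ex ub) => m /asboolP Qm hm.
exists m%:Z; split=> [|s]; first by lia.
split=> [|hQ]; first by move=> h; apply: Qle Qm; lia.
by have := hm s (asboolT hQ); lia.
Qed.

Lemma rankN1P (X : choiceType) (hX : inhabited X)
    (eqv : {freeg X} -> {freeg X} -> Prop) (eqvE : Equivalence eqv)
    (E1 : forall D D' : {freeg X}, eqv D D' -> deg D = deg D')
    (E2 : forall D1 D1' D2 D2' : {freeg X},
       eqv D1 D1' -> eqv D2 D2' -> eqv (D1 + D2) (D1' + D2'))
    (D : {freeg X}) :
  rank eqv D = -1 <-> linsys eqv D = set0.
Proof.
have [ge hr] := rankP hX eqvE E1 E2 D; have [h1 h2] := hr 0%N.
split=> [r1|L0].
  apply/eqP; apply: contrapT => /negP/set0P LD; suff: 0 <= rank eqv D by lia.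
  by apply: h2 => E hE dE; rewrite (deg_effective_eq0 hE dE) subr0.
case: (leP 0 (rank eqv D)) => [/h1/(_ 0)|]; last by lia.
rewrite subr0 L0 => -[||x //]; last by rewrite deg0.
by move=> x; rewrite coeff0.
Qed.

(* Main.v *)
Require Import Defs.
From mathcomp Require Import zify.

(* If |D| and |D'| are nonempty, so is |D + D'|.
   If RR1 and RR2 hold but r(D) < s := r(K - D) + deg D + 1 - g with s >= 0,
   choose E >= 0 of degree s with |D - E| empty; RR1 yields nu in N and
   F >= 0 with F ~ nu - D + E, so deg F = r(K - D) and |K - D - F| is
   nonempty.  Adding E, the system of K - D - F + E ~ K - nu is nonempty,
   against RR2.  This gives one inequality; exchanging D and K - D gives
   the other one.  Conversely, if |D| is empty, the formula says
   r(K - D) = m - 1 with m = g - 1 - deg D, so |K - D - E| is empty for some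
   E >= 0 of degree m, and nu = D + E works by RR2; if |D| is nonempty, every
   nu in N works, and N is nonempty by the case of a D of negative degree. *)

Set Implicit Arguments.
Unset Strict Implicit.
Unset Printing Implicit Defensive.

Import Order.TTheory GRing.Theory Num.Theory.
Local Open Scope ring_scope.
Local Open Scope classical_set_scope.

Lemma eps_add_eq0 (X : choiceType) (eqv : {freeg X} -> {freeg X} -> Prop)
    (D D' : {freeg X}) :
  eps eqv D + eps eqv D' = 0 <->
  (linsys eqv D !=set0 <-> linsys eqv D' !=set0).
Proof.
rewrite /eps; do 2![case: asboolP => ?]; split=> [/eqP //|?]; try tauto;
  by apply/eqP; first [done | exfalso; tauto].
Qed.

Lemma eps_add_eq1 (X : choiceType) (eqv : {freeg X} -> {freeg X} -> Prop)
    (D D' : {freeg X}) :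
  eps eqv D + eps eqv D' = 1 <->
  (linsys eqv D !=set0 <-> ~ (linsys eqv D' !=set0)).
Proof.
rewrite /eps; do 2![case: asboolP => ?]; split=> [/eqP //|?]; try tauto;
  by apply/eqP; first [done | exfalso; tauto].
Qed.

Lemma calNP (X : choiceType) (eqv : {freeg X} -> {freeg X} -> Prop)
    (g : nat) (D : {freeg X}) :
  calN eqv g D <-> deg D = g%:Z - 1 /\ ~ (linsys eqv D !=set0).
Proof.
by split=> -[dD LD]; split=> //; [rewrite LD => -[] | apply/nonemptyPn].
Qed.

Section LinearSystems.
Variables (X : choiceType) (eqv : {freeg X} -> {freeg X} -> Prop).
Hypothesis eqvE : Equivalence eqv.
Hypothesis E1 : forall D D' : {freeg X}, eqv D D' -> deg D = deg D'.
Hypothesis E2 : forall D1 D1' D2 D2' : {freeg X},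
  eqv D1 D1' -> eqv D2 D2' -> eqv (D1 + D2) (D1' + D2').

Lemma linsys_effective (E : {freeg X}) : effective E -> linsys eqv E !=set0.
Proof. by move=> hE; exists E; split=> //; reflexivity. Qed.

Lemma linsysD (D D' : {freeg X}) :
  linsys eqv D !=set0 -> linsys eqv D' !=set0 -> linsys eqv (D + D') !=set0.
Proof.
move=> [F [hF eF]] [F' [hF' eF']]; exists (F + F').
by split; [exact: effectiveD | exact: E2].
Qed.

Lemma linsys_eqv (D D' : {freeg X}) :
  eqv D D' -> linsys eqv D !=set0 -> linsys eqv D' !=set0.
Proof. by move=> eDD' [F [hF eF]]; exists F; split=> //; transitivity D. Qed.

Hypothesis hX : inhabited X.

Lemma rank_ge0P (D : {freeg X}) : 0 <= rank eqv D <-> linsys eqv D !=set0.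
Proof.
have [geN1 _] := rankP hX eqvE E1 E2 D; have [rL Lr] := rankN1P hX eqvE E1 E2 D.
split=> [r_ge0|/set0P/eqP LD]; last first.
  by have := contra_not rL LD; lia.
by apply/set0P/eqP => /Lr; lia.
Qed.

Lemma rank_lt_nat (D : {freeg X}) (s : nat) : rank eqv D < s%:Z ->
  exists E, [/\ effective E, deg E = s%:Z & ~ (linsys eqv (D - E) !=set0)].
Proof.
have [_ hr] := rankP hX eqvE E1 E2 D; move=> lt_rs.
apply: contrapT => hE; suff : s%:Z <= rank eqv D by lia.
by apply/hr => E effE dE; apply: contrapT => LE; apply: hE; exists E.
Qed.

(** An effective [E] has degree at least 0, so [rank eqv D] cannot be -1 here and the definition of
    rank applies at [s = deg E]. *)
Lemma linsys_sub_rank (D E : {freeg X}) :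
  effective E -> deg E = rank eqv D -> linsys eqv (D - E) !=set0.
Proof.
move=> effE dE; have [_ hr] := rankP hX eqvE E1 E2 D.
have := deg_effective_ge0 effE; case dEs: (deg E) => [s|//] _.
have le_sr : s%:Z <= rank eqv D by rewrite -dE dEs.
exact: (hr s).1.
Qed.

Lemma rank_ge_of_RR (g : nat) (K D : {freeg X}) :
  (forall D, ~ (linsys eqv D !=set0) ->
     exists2 nu, calN eqv g nu & linsys eqv (nu - D) !=set0) ->
  (forall nu, calN eqv g nu -> ~ (linsys eqv (K - nu) !=set0)) ->
  rank eqv (K - D) + deg D + 1 - g%:Z <= rank eqv D.
Proof.
move=> RR1 RR2; rewrite leNgt; apply/negP => lt_r.
have [geN1 _] := rankP hX eqvE E1 E2 D.
(* A negative bound is impossible, since ranks are at least -1. *)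
case sE: (rank eqv (K - D) + deg D + 1 - g%:Z) lt_r => [s|s]; last by lia.
move=> /rank_lt_nat[E [effE dE /RR1[nu Nnu [F [effF eF]]]]].
apply: (RR2 _ Nnu); have [dnu _] := Nnu.
have dF : deg F = rank eqv (K - D) by rewrite (E1 eF) !degB dnu dE; lia.
have := linsysD (linsys_sub_rank effF dF) (linsys_effective effE).
apply: linsys_eqv; symmetry.
have -> : K - nu = F + (K - nu - F) by rewrite [RHS]addrC subrK.
have -> : K - D - F + E = nu - (D - E) + (K - nu - F).
  by rewrite [RHS]addrC [K - nu - F]addrAC subrKA opprB addrA (addrAC K) [LHS]addrAC.
by apply: E2 => //; reflexivity.
Qed.

(** This is (RR1) for an empty |D|: there [eps eqv D = 1], so |nu - D| has to be nonempty. *)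
Lemma calN_of_RR (g : nat) (K D : {freeg X}) :
  (forall D, rank eqv D - rank eqv (K - D) = deg D + 1 - g%:Z) ->
  ~ (linsys eqv D !=set0) ->
  exists2 nu, calN eqv g nu & linsys eqv (nu - D) !=set0.
Proof.
move=> RR LD.
have rD : rank eqv D = -1 by apply/(rankN1P hX eqvE E1 E2)/nonemptyPn.
have [geN1 _] := rankP hX eqvE E1 E2 (K - D).
have := RR D; rewrite rD => rKD.
(* The formula gives [rank eqv (K - D) = m - 1], and ranks are at least -1, so [m] is a natural
   number. *)
case mE: (g%:Z - 1 - deg D) => [m|m]; last by lia.
have /rank_lt_nat[E [effE dE LE]] : rank eqv (K - D) < m%:Z by lia.
exists (D + E); last by rewrite addrC addKr; exact: linsys_effective.
have dDE : deg (D + E) = g%:Z - 1 by rewrite degD; lia.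
(* In degree [g - 1] the formula equates the ranks of [D + E] and [K - D - E], and the system of the
   latter is empty. *)
apply/calNP; split=> // /(rank_ge0P (D + E)) rDE; apply: LE; apply/rank_ge0P.
by have := RR (D + E); rewrite dDE opprD addrA subrK subrr => /subr0_eq <-.
Qed.

End LinearSystems.

Theorem theorem2p2 (X : choiceType) (hX : inhabited X)
    (eqv : {freeg X} -> {freeg X} -> Prop) (eqvE : Equivalence eqv)
    (E1 : forall D D' : {freeg X}, eqv D D' -> deg D = deg D')
    (E2 : forall D1 D1' D2 D2' : {freeg X},
       eqv D1 D1' -> eqv D2 D2' -> eqv (D1 + D2) (D1' + D2'))
    (g : nat) (K : {freeg X}) (hK : deg K = 2 * g%:Z - 2) :
  (forall D : {freeg X},
     rank eqv D - rank eqv (K - D) = deg D + 1 - g%:Z) <->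
  ((forall D : {freeg X}, exists nu : {freeg X},
      calN eqv g nu /\ eps eqv D + eps eqv (nu - D) = 1) /\
   (forall D : {freeg X}, deg D = g%:Z - 1 ->
      eps eqv D + eps eqv (K - D) = 0)).
Proof.
split=> [RR|[RR1 RR2] D].
  split=> D; last first.
    move=> dD; apply/eps_add_eq0; rewrite -!(rank_ge0P eqvE E1 E2 hX).
    by have := RR D; rewrite dD; lia.
  have exN D' := @calN_of_RR _ _ eqvE E1 E2 hX g K D' RR.
  have [LD|LD] := pselect (linsys eqv D !=set0); last first.
    by have [nu Nnu Lnu] := exN D LD; exists nu; split=> //; apply/eps_add_eq1.
  case: (hX) => x0.
  have [|nu Nnu _] := exN (- << 1 *g x0 >>).
    move=> [F [effF /E1]]; have := deg_effective_ge0 effF.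
    by rewrite degN degU; lia.
  exists nu; split=> //; apply/eps_add_eq1; split=> // _ Lnu.
  have [_] := (calNP _ _ _).1 Nnu; apply.
  (* If |nu - D| were nonempty, so would be the system of [nu = (nu - D) + D]. *)
  by rewrite -(subrK D nu); exact: linsysD.
have rr1 D' : ~ (linsys eqv D' !=set0) ->
    exists2 nu, calN eqv g nu & linsys eqv (nu - D') !=set0.
  move=> LD'; have [nu [Nnu /eps_add_eq1 e]] := RR1 D'; exists nu => //.
  by apply: contrapT => /e.
have rr2 nu : calN eqv g nu -> ~ (linsys eqv (K - nu) !=set0).
  by move=> /calNP[/RR2/eps_add_eq0 e Lnu] /e.
(* As [deg (K - D) = 2g - 2 - deg D], the inequality at [K - D] is the reverse of the one at [D]. *)
have := rank_ge_of_RR eqvE E1 E2 hX D rr1 rr2.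
have := rank_ge_of_RR eqvE E1 E2 hX (K - D) rr1 rr2.
by rewrite subKr degB hK; lia.
Qed.
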